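(* For every DM-sequent $\Sigma\Rightarrow\varphi$, if $\mathsf{G3DM}\vdash\Sigma\Rightarrow\varphi$, then every partition of $\Sigma\Rightarrow\varphi$ has an interpolant. That is, whenever $\Sigma$ is the multiset union of DM-structures $\Sigma_1$ and $\Sigma_2$, there is a term $\psi$ such that (i) $\mathsf{G3DM}\vdash\Sigma_1\Rightarrow\psi$, (ii) $\mathsf{G3DM}\vdash\psi,\Sigma_2\Rightarrow\varphi$, and (iii) $var(\psi)\subseteq var(\Sigma_1)\cap var(\Sigma_2,\varphi)$.
   Context: Let $\Xi=\{p_n\mid n\in\omega\}$ be a denumerable set of propositional variables. Terms are generated by $\varphi::=p\mid\bot\mid{\sim}\varphi\mid(\varphi\wedge\varphi)\mid(\varphi\vee\varphi)$ with $p\in\Xi$. A DM-structure is a finite multiset of terms (possibly empty); the comma denotes multiset union. A DM-sequent is $\Sigma\Rightarrow\varphi$ with $\Sigma$ a DM-structure and $\varphi$ a term. $var$ of a term or of a multiset of terms is the set of propositional variables occurring in it. A partition of $\Sigma\Rightarrow\varphi$ is $(\Sigma_1;\emptyset)(\Sigma_2;\varphi)$ where the multiset union of $\Sigma_1$ and $\Sigma_2$ equals $\Sigma$; an interpolant of it is a term $\psi$ satisfying (i)--(iii) of the claim. The calculus $\mathsf{G3DM}$ (with $p\in\Xi$, all Greek lowercase letters arbitrary terms, $\Sigma$ an arbitrary DM-structure) has axioms: $p,\Sigma\Rightarrow p$; ${\sim}p,\Sigma\Rightarrow{\sim}p$; $\bot,\Sigma\Rightarrow\varphi$; $\Sigma\Rightarrow{\sim}\bot$.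 Rules: from $\varphi,\psi,\Sigma\Rightarrow\chi$ infer $\varphi\wedge\psi,\Sigma\Rightarrow\chi$; from $\Sigma\Rightarrow\varphi$ and $\Sigma\Rightarrow\psi$ infer $\Sigma\Rightarrow\varphi\wedge\psi$; from $\varphi,\Sigma\Rightarrow\chi$ and $\psi,\Sigma\Rightarrow\chi$ infer $\varphi\vee\psi,\Sigma\Rightarrow\chi$; from $\Sigma\Rightarrow\varphi_i$ ($i=1$ or $2$) infer $\Sigma\Rightarrow\varphi_1\vee\varphi_2$; from ${\sim}\varphi,\Sigma\Rightarrow\chi$ and ${\sim}\psi,\Sigma\Rightarrow\chi$ infer ${\sim}(\varphi\wedge\psi),\Sigma\Rightarrow\chi$; from $\Sigma\Rightarrow{\sim}\varphi_i$ ($i=1$ or $2$) infer $\Sigma\Rightarrow{\sim}(\varphi_1\wedge\varphi_2)$; from ${\sim}\varphi,{\sim}\psi,\Sigma\Rightarrow\chi$ infer ${\sim}(\varphi\vee\psi),\Sigma\Rightarrow\chi$; from $\Sigma\Rightarrow{\sim}\varphi$ and $\Sigma\Rightarrow{\sim}\psi$ infer $\Sigma\Rightarrow{\sim}(\varphi\vee\psi)$; from $\varphi,\Sigma\Rightarrow\chi$ infer ${\sim}{\sim}\varphi,\Sigma\Rightarrow\chi$; from $\Sigma\Rightarrow\varphi$ infer $\Sigma\Rightarrow{\sim}{\sim}\varphi$. $\mathsf{G3DM}\vdash\Sigma\Rightarrow\varphi$ means that $\Sigma\Rightarrow\varphi$ has a derivation from these axioms by these rules. *)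

(* Defs.v *)
From HB Require Import structures.
From mathcomp Require Import all_boot.
From mathcomp Require Import finmap multiset.

Set Implicit Arguments.
Unset Strict Implicit.
Unset Printing Implicit Defensive.

Local Open Scope mset_scope.

(* [TVar n] is the propositional variable p_n. *)
Inductive term : Type :=
| TVar of nat
| TBot
| TNeg of term
| TAnd of term & term
| TOr of term & term.

(* {mset term} needs a choiceType structure on terms, obtained here by
   encoding them as generic trees. *)
Fixpoint term_encode (t : term) : GenTree.tree nat :=
  match t with
  | TVar n => GenTree.Leaf n
  | TBot => GenTree.Node 0 [::]
  | TNeg a => GenTree.Node 1 [:: term_encode a]
  | TAnd a b => GenTree.Node 2 [:: term_encode a; term_encode b]
  | TOr a b => GenTree.Node 3 [:: term_encode a; term_encode b]
  end.

Fixpoint term_decode (t : GenTree.tree nat) : term :=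
  match t with
  | GenTree.Leaf n => TVar n
  | GenTree.Node 1 [:: a] => TNeg (term_decode a)
  | GenTree.Node 2 [:: a; b] => TAnd (term_decode a) (term_decode b)
  | GenTree.Node 3 [:: a; b] => TOr (term_decode a) (term_decode b)
  | _ => TBot
  end.

Lemma term_encodeK : cancel term_encode term_decode.
Proof. by elim=> //= [a ->|a -> b ->|a -> b ->]. Qed.

HB.instance Definition _ := Countable.copy term (can_type term_encodeK).

Declare Scope term_scope.
Delimit Scope term_scope with term.
Bind Scope term_scope with term.
Notation "⊥" := TBot : term_scope.
Notation "∼ a" := (TNeg a) (at level 35, right associativity) : term_scope.
Notation "a ∧ b" := (TAnd a b) (at level 40, left associativity) : term_scope.
Notation "a ∨ b" := (TOr a b) (at level 45, left associativity) : term_scope.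

Fixpoint var (t : term) : {fset nat} :=
  match t with
  | TVar n => [fset n]%fset
  | TBot => fset0%fset
  | TNeg a => var a
  | TAnd a b => (var a `|` var b)%fset
  | TOr a b => (var a `|` var b)%fset
  end.

Definition var_mset (S : {mset term}) : {fset nat} :=
  (\bigcup_(t <- S) var t)%fset.

(* [G3DM S phi] : the sequent S => phi is derivable.  [a +` S] is the multiset
   S with one more occurrence of a, and [S `+` T] below is the multiset union
   that adds multiplicities (as opposed to [S `|` T], which takes maxima). *)
Inductive G3DM : {mset term} -> term -> Prop :=
| ax_var (n : nat) (S : {mset term}) : G3DM (TVar n +` S) (TVar n)
| ax_neg_var (n : nat) (S : {mset term}) : G3DM ((∼ TVar n)%term +` S) (∼ TVar n)
| ax_bot (S : {mset term}) (c : term) : G3DM (⊥%term +` S) c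
| ax_neg_bot (S : {mset term}) : G3DM S (∼ ⊥)
| and_l (a b : term) (S : {mset term}) (c : term) :
    G3DM (a +` (b +` S)) c -> G3DM ((a ∧ b)%term +` S) c
| and_r (a b : term) (S : {mset term}) :
    G3DM S a -> G3DM S b -> G3DM S (a ∧ b)
| or_l (a b : term) (S : {mset term}) (c : term) :
    G3DM (a +` S) c -> G3DM (b +` S) c -> G3DM ((a ∨ b)%term +` S) c
| or_r1 (a b : term) (S : {mset term}) :
    G3DM S a -> G3DM S (a ∨ b)
| or_r2 (a b : term) (S : {mset term}) :
    G3DM S b -> G3DM S (a ∨ b)
| neg_and_l (a b : term) (S : {mset term}) (c : term) :
    G3DM ((∼ a)%term +` S) c -> G3DM ((∼ b)%term +` S) c ->
    G3DM ((∼ (a ∧ b))%term +` S) c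
| neg_and_r1 (a b : term) (S : {mset term}) :
    G3DM S (∼ a) -> G3DM S (∼ (a ∧ b))
| neg_and_r2 (a b : term) (S : {mset term}) :
    G3DM S (∼ b) -> G3DM S (∼ (a ∧ b))
| neg_or_l (a b : term) (S : {mset term}) (c : term) :
    G3DM ((∼ a)%term +` ((∼ b)%term +` S)) c -> G3DM ((∼ (a ∨ b))%term +` S) c
| neg_or_r (a b : term) (S : {mset term}) :
    G3DM S (∼ a) -> G3DM S (∼ b) -> G3DM S (∼ (a ∨ b))
| neg_neg_l (a : term) (S : {mset term}) (c : term) :
    G3DM (a +` S) c -> G3DM ((∼ ∼ a)%term +` S) c
| neg_neg_r (a : term) (S : {mset term}) :
    G3DM S a -> G3DM S (∼ ∼ a).

Definition is_partition (S S1 S2 : {mset term}) : Prop := S1 `+` S2 = S.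

Definition interpolant (S1 S2 : {mset term}) (phi psi : term) : Prop :=
  [/\ G3DM S1 psi,
      G3DM (psi +` S2) phi
    & (var psi `<=` var_mset S1 `&` var_mset (phi +` S2))%fset].

(* Main.v *)
Require Import Defs.
From mathcomp Require Import all_boot.
From mathcomp Require Import finmap multiset.

(** Maehara's method: an interpolant for every partition is built by induction
    on the derivation.

    If the last rule acts on the right, or on a formula of the second component
    [S2], interpolants of the premises are conjoined; if it acts on a formula
    of the first component [S1], they are disjoined.  A rule with one premise
    keeps the interpolant of that premise.  An axiom has as interpolant its
    principal formula or [∼ ⊥] (which serves as truth), according to the
    component that holds the principal formula.

    That this works does not depend on which connective the rule introduces,
    only on two features shared by all rules of the calculus: they leave the
    context unchanged, and every variable of a side formula occurs in the
    principal formula.  The argument is therefore made once for each shape of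
    rule (left or right, one or two premises): [interpolable_left1],
    [interpolable_left2], [interpolable_right1], [interpolable_right2].
    Conjoining interpolants puts both of them in the antecedent where each
    premise provides only one; this is where [G3DM_weakening] is used. *)

Local Open Scope mset_scope.

Definition interpolable (S : {mset term}) (c : term) : Prop :=
  forall S1 S2 : {mset term}, is_partition S S1 S2 ->
  exists psi : term, interpolant S1 S2 c psi.

Lemma var_msetD (S T : {mset term}) :
  var_mset (S `+` T) = (var_mset S `|` var_mset T)%fset.
Proof.
apply/fsetP => n; rewrite inE; apply/bigfcupP/orP => /=.
- case=> t; rewrite andbT in_msetD => /orP[] tS nt; [left|right];
  by apply/bigfcupP; exists t; rewrite ?tS.
- by case=> /bigfcupP[t /andP[tS _] nt]; exists t; rewrite ?in_msetD ?tS ?orbT.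
Qed.

Lemma var_mset1 (a : term) : var_mset [mset a] = var a.
Proof. by rewrite /var_mset enum_msetn big_seq1. Qed.

Lemma partition_cons (x : term) (S S1 S2 : {mset term}) :
  is_partition (x +` S) S1 S2 ->
  (exists2 T, S1 = x +` T & is_partition S T S2) \/
  (exists2 T, S2 = x +` T & is_partition S S1 T).
Proof.
rewrite /is_partition => eS.
have : x \in S1 `+` S2 by rewrite eS mset1D1.
case/msetDP => /msetB1K xK; [left; exists (S1 `\ x) | right; exists (S2 `\ x)];
  rewrite ?xK //; apply: (can_inj (msetDKB [mset x])).
- by rewrite msetDA xK.
- by rewrite msetDCA xK.
Qed.

(** Every axiom and rule has an arbitrary context, so a new formula can be
    carried through the whole derivation. *)
Lemma G3DM_weakening (x : term) (S : {mset term}) (c : term) :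
  G3DM S c -> G3DM (x +` S) c.
Proof.
elim=> {S c} [n S|n S|S c|S|a b S c _|a b S _ IHa _ IHb|a b S c _ IHa _ IHb
  |a b S _|a b S _|a b S c _ IHa _ IHb|a b S _|a b S _|a b S c _
  |a b S _ IHa _ IHb|a S c _|a S _].
- by rewrite msetDCA; apply: ax_var.
- by rewrite msetDCA; apply: ax_neg_var.
- by rewrite msetDCA; apply: ax_bot.
- exact: ax_neg_bot.
- move=> d; rewrite msetDCA; apply: and_l.
  by rewrite (msetDCA [mset b]) msetDCA.
- exact: and_r.
- by rewrite msetDCA; apply: or_l; rewrite msetDCA.
- exact: or_r1.
- exact: or_r2.
- by rewrite msetDCA; apply: neg_and_l; rewrite msetDCA.
- exact: neg_and_r1.
- exact: neg_and_r2.
- move=> d; rewrite msetDCA; apply: neg_or_l.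
  by rewrite (msetDCA [mset (∼ b)%term]) msetDCA.
- exact: neg_or_r.
- by move=> d; rewrite msetDCA; apply: neg_neg_l; rewrite msetDCA.
- exact: neg_neg_r.
Qed.

(** The side formulas form a multiset [D] so that rules with one side formula
    and rules with two are covered alike. *)
Lemma interpolable_left1 (x : term) (D S : {mset term}) (c : term) :
  (forall T d, G3DM (D `+` T) d -> G3DM (x +` T) d) ->
  (var_mset D `<=` var x)%fset ->
  interpolable (D `+` S) c -> interpolable (x +` S) c.
Proof.
move=> rule varD IH S1 S2 /partition_cons[] [T -> eS].
- have [|psi [d1 d2 v]] := IH (D `+` T) S2; first by rewrite /is_partition -eS msetDA.
  exists psi; split=> //; first exact: rule.
  apply: fsubset_trans v _; apply: fsetSI.
  by rewrite !var_msetD var_mset1 fsetSU.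
- have [|psi [d1 d2 v]] := IH S1 (D `+` T); first by rewrite /is_partition -eS msetDCA.
  exists psi; split=> //; first by rewrite msetDCA; apply: rule; rewrite msetDCA.
  apply: fsubset_trans v _; apply: fsetIS.
  by rewrite !var_msetD !var_mset1 fsetUS ?fsetSU.
Qed.

(** When [x] lies in the first component, the premises prove different
    interpolants [p] and [q] from different antecedents, and only their
    disjunction follows from both; dually, when [x] lies in the second
    component, the premises use different interpolants, and only their
    conjunction can serve both. *)
Lemma interpolable_left2 (x a b : term) (S : {mset term}) (c : term) :
  (forall T d, G3DM (a +` T) d -> G3DM (b +` T) d -> G3DM (x +` T) d) ->
  (var a `<=` var x)%fset -> (var b `<=` var x)%fset ->
  interpolable (a +` S) c -> interpolable (b +` S) c ->
  interpolable (x +` S) c.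
Proof.
move=> rule va vb IHa IHb S1 S2 /partition_cons[] [T -> eS].
- have [|p [p1 p2 vp]] := IHa (a +` T) S2; first by rewrite /is_partition -eS msetDA.
  have [|q [q1 q2 vq]] := IHb (b +` T) S2; first by rewrite /is_partition -eS msetDA.
  exists (p ∨ q)%term; split; last 1 first.
  + rewrite /= fsubUset; apply/andP; split.
    * by apply: fsubset_trans vp _; rewrite !var_msetD !var_mset1 fsetSI ?fsetSU.
    * by apply: fsubset_trans vq _; rewrite !var_msetD !var_mset1 fsetSI ?fsetSU.
  + by apply: rule; [apply: or_r1|apply: or_r2].
  + exact: or_l.
- have [|p [p1 p2 vp]] := IHa S1 (a +` T); first by rewrite /is_partition -eS msetDCA.
  have [|q [q1 q2 vq]] := IHb S1 (b +` T); first by rewrite /is_partition -eS msetDCA.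
  exists (p ∧ q)%term; split; last 1 first.
  + rewrite /= fsubUset; apply/andP; split.
    * by apply: fsubset_trans vp _;
        rewrite !var_msetD !var_mset1 fsetIS ?fsetUS ?fsetSU.
    * by apply: fsubset_trans vq _;
        rewrite !var_msetD !var_mset1 fsetIS ?fsetUS ?fsetSU.
  + exact: and_r.
  + apply: and_l; rewrite (msetDCA [mset q]) msetDCA; apply: rule.
    * rewrite (msetDCA [mset p]) msetDCA; apply: G3DM_weakening.
      by rewrite msetDCA.
    * by rewrite msetDCA; apply: G3DM_weakening; rewrite msetDCA.
Qed.

Lemma interpolable_right1 (x a : term) (S : {mset term}) :
  (forall T, G3DM T a -> G3DM T x) -> (var a `<=` var x)%fset ->
  interpolable S a -> interpolable S x.
Proof.
move=> rule va IH S1 S2 /IH[psi [d1 d2 v]].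
exists psi; split=> //; first exact: rule.
by apply: fsubset_trans v _; rewrite !var_msetD !var_mset1 fsetIS ?fsetSU.
Qed.

Lemma interpolable_right2 (x a b : term) (S : {mset term}) :
  (forall T, G3DM T a -> G3DM T b -> G3DM T x) ->
  (var a `<=` var x)%fset -> (var b `<=` var x)%fset ->
  interpolable S a -> interpolable S b -> interpolable S x.
Proof.
move=> rule va vb IHa IHb S1 S2 eS.
have [p [p1 p2 vp]] := IHa _ _ eS; have [q [q1 q2 vq]] := IHb _ _ eS.
exists (p ∧ q)%term; split; first exact: and_r.
- apply/and_l/rule; last exact: G3DM_weakening.
  by rewrite msetDCA; apply: G3DM_weakening.
- rewrite /= fsubUset; apply/andP; split.
  + by apply: fsubset_trans vp _; rewrite !var_msetD !var_mset1 fsetIS ?fsetSU.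
  + by apply: fsubset_trans vq _; rewrite !var_msetD !var_mset1 fsetIS ?fsetSU.
Qed.

(** [∼ ⊥] is derivable from anything and has no variables, so it interpolates
    as soon as the second component alone yields the conclusion. *)
Lemma interpolant_true (S1 S2 : {mset term}) (c : term) :
  G3DM S2 c -> interpolant S1 S2 c (∼ ⊥).
Proof.
by move=> d; split; [exact: ax_neg_bot | exact: G3DM_weakening | exact: fsub0set].
Qed.

(** A literal is derivable from itself in any context, so it interpolates when
    its antecedent occurrence lies in the first component. *)
Lemma interpolable_id (x : term) (S : {mset term}) :
  (forall T, G3DM (x +` T) x) -> interpolable (x +` S) x.
Proof.
move=> ax S1 S2 /partition_cons[] [T -> _].
- exists x; split=> //.
  by rewrite !var_msetD !var_mset1 fsubsetI !fsubsetUl.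
- by exists (∼ ⊥)%term; apply: interpolant_true.
Qed.

Theorem theorem4p12 (S : {mset term}) (phi : term) :
  G3DM S phi ->
  forall S1 S2 : {mset term}, is_partition S S1 S2 ->
  exists psi : term, interpolant S1 S2 phi psi.
Proof.
rewrite -/(interpolable S phi).
elim=> {S phi} [n S|n S|S c|S|a b S c _ IH|a b S _ IHa _ IHb
  |a b S c _ IHa _ IHb|a b S _ IH|a b S _ IH|a b S c _ IHa _ IHb|a b S _ IH
  |a b S _ IH|a b S c _ IH|a b S _ IHa _ IHb|a S c _ IH|a S _ IH].
- by apply: interpolable_id => T; apply: ax_var.
- by apply: interpolable_id => T; apply: ax_neg_var.
- move=> S1 S2 /partition_cons[] [T -> _].
  + by exists ⊥%term; split; [apply: ax_bot | apply: ax_bot | exact: fsub0set].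
  + by exists (∼ ⊥)%term; apply/interpolant_true/ax_bot.
- by move=> S1 S2 _; exists (∼ ⊥)%term; apply/interpolant_true/ax_neg_bot.
- apply: (@interpolable_left1 _ (a +` [mset b])); last by rewrite -msetDA.
  + by move=> T d; rewrite -msetDA; apply: and_l.
  + by rewrite var_msetD !var_mset1.
- by apply: interpolable_right2 IHa IHb; rewrite ?fsubsetUl ?fsubsetUr // => T;
    apply: and_r.
- by apply: interpolable_left2 IHa IHb; rewrite ?fsubsetUl ?fsubsetUr // => T d;
    apply: or_l.
- by apply: interpolable_right1 IH; rewrite ?fsubsetUl // => T; apply: or_r1.
- by apply: interpolable_right1 IH; rewrite ?fsubsetUr // => T; apply: or_r2.
- by apply: interpolable_left2 IHa IHb; rewrite ?fsubsetUl ?fsubsetUr // => T d;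
    apply: neg_and_l.
- by apply: interpolable_right1 IH; rewrite ?fsubsetUl // => T; apply: neg_and_r1.
- by apply: interpolable_right1 IH; rewrite ?fsubsetUr // => T; apply: neg_and_r2.
- apply: (@interpolable_left1 _ ((∼ a)%term +` [mset (∼ b)%term]));
    last by rewrite -msetDA.
  + by move=> T d; rewrite -msetDA; apply: neg_or_l.
  + by rewrite var_msetD !var_mset1.
- by apply: interpolable_right2 IHa IHb; rewrite ?fsubsetUl ?fsubsetUr // => T;
    apply: neg_or_r.
- by apply: interpolable_left1 IH; [move=> T d; apply: neg_neg_l | rewrite var_mset1].
- by apply: interpolable_right1 IH; [move=> T; apply: neg_neg_r | ].
Qed.
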